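(* Let $q=p^\alpha$ with $p$ prime, and let $\gamma$ be a fixed generator of $\mathbb F_q^*$. Let $(\gamma^{(q-1)/d},0,H)\in\mathcal S$, where $1<d\mid q-1$, and let $|H|=p^\beta$. Then for every integer $0\le k\le q$, $$\mathcal N(S(\gamma^{(q-1)/d},0,H),k)=\sum_{P\subset\mathcal P((|H'|-1)/d)}\ \sum_{0\le l\le(\alpha-\beta)/o_{d\,\Pi P}(p)}(-1)^{|P|+l}\,p^{o_{d\,\Pi P}(p)\binom l2}{(\alpha-\beta)/o_{d\,\Pi P}(p)\brack l}_{p^{o_{d\,\Pi P}(p)}}\, s_{q,k}\bigl(d\,\Pi P,\,p^{\beta+l\,o_{d\,\Pi P}(p)}\bigr).$$
   Context: $\mathbb F_q$ is the field with $q=p^\alpha$ elements, $p$ prime. $\mathrm{AGL}(1,\mathbb F_q)=\left\{\left[\begin{smallmatrix}a&b\\0&1\end{smallmatrix}\right]:a\in\mathbb F_q^*,\ b\in\mathbb F_q\right\}$ acts on $\mathbb F_q$ by $\left[\begin{smallmatrix}a&b\\0&1\end{smallmatrix}\right]x=ax+b$. For $B\subset\mathbb F_q$, $\mathrm{AGL}(1,\mathbb F_q)_B=\{\sigma:\sigma(B)=B\}$ is the (setwise) stabilizer. $\mathcal S$ is the set of triples $(a,b,H)$ with $a\in\mathbb F_q^*$, $H$ an $\mathbb F_p(a)$-subspace of $\mathbb F_q$, and $b=0$ if $a=1$, $b\in\mathbb F_q$ if $a\ne1$. Let $\overline H=\left\{\left[\begin{smallmatrix}1&h\\0&1\end{smallmatrix}\right]:h\in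 H\right\}$ and let $S(a,b,H)$ be the subgroup of $\mathrm{AGL}(1,\mathbb F_q)$ generated by $\left[\begin{smallmatrix}a&b\\0&1\end{smallmatrix}\right]$ and $\overline H$. For a subgroup $S$ of $\mathrm{AGL}(1,\mathbb F_q)$, $\mathcal N(S,k)$ is the number of subsets $B\subset\mathbb F_q$ with $|B|=k$ and $\mathrm{AGL}(1,\mathbb F_q)_B=S$. $H'=\{x\in\mathbb F_q:xH\subset H\}$, a subfield of $\mathbb F_q$ (the largest subfield $K$ such that $H$ is a $K$-module). For a positive integer $u$, $\mathcal P(u)$ is the set of prime divisors of $u$; $o_u(v)$ is the multiplicative order of $v$ modulo $u$ when $\gcd(u,v)=1$. For a finite set $P$ of integers, $\Pi P=\prod_{e\in P}e$ (so $\Pi\emptyset=1$). ${n\brack m}_Q=\prod_{i=0}^{m-1}\frac{1-Q^{n-i}}{1-Q^{i+1}}$ is the Gaussian binomial coefficient. For integers $u,v>0$, $s_{q,k}(u,v)=\binom{(q-v)/uv}{k/uv}+\binom{(q-v)/uv}{(k-v)/uv}$, where $\binom xy:=0$ if $y$ is not a nonnegative integer. *)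

(* Defs.v *)
From HB Require Import structures.
From mathcomp Require Import all_boot all_order all_fingroup all_algebra.
From mathcomp Require Import all_solvable all_field.

Set Implicit Arguments.
Unset Strict Implicit.
Unset Printing Implicit Defensive.

Import Order.TTheory GRing.Theory Num.Theory.

Local Open Scope ring_scope.

Section AGL.

Variable F : finFieldType.
Implicit Types (g : {'GL_2[F]}) (a : {unit F}) (b x : F) (B H : {set F}).

Definition AGL1 : {set {'GL_2[F]}} :=
  [set g : {'GL_2[F]} |
    (GLval g (1 : 'I_2) (0 : 'I_2) == 0) && (GLval g (1 : 'I_2) (1 : 'I_2) == 1)].

Lemma AGL1_group_set : group_set AGL1.
Proof.
apply/group_setP; split=> [|g h].
  by rewrite inE GL_1E !mxE !eqxx.
rewrite !inE GL_MxE !mxE !big_ord_recl !big_ord0.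
have ->: lift ord0 (@ord0 0) = 1 :> 'I_2 by apply: val_inj.
have -> : ord0 = 0 :> 'I_2 by [].
case/andP=> /eqP-> /eqP-> /andP[/eqP-> /eqP->].
by rewrite !mul0r !mul1r !add0r !addr0 !eqxx.
Qed.

Canonical AGL1_group := Group AGL1_group_set.

Definition affine_mx (a b : F) : 'M[F]_2 :=
  \matrix_(i, j) (if i == 0 then (if j == 0 then a else b) else (j == 1)%:R).

Lemma affine_mx_unit a b : affine_mx (val a) b \is a GRing.unit.
Proof.
rewrite -[_ \is a GRing.unit]/(_ \in unitmx) unitmxE -det_tr det_trig.
  by rewrite !big_ord_recl big_ord0 !mxE /= !mulr1 (valP a).
by apply/is_trig_mxP => -[[|[]]] // ? -[[|[]]] // ? _; rewrite !mxE.
Qed.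

Definition affine a b : {'GL_2[F]} := FinRing.unit _ (affine_mx_unit a b).

Definition AGL1_act g x : F :=
  GLval g (0 : 'I_2) (0 : 'I_2) * x + GLval g (0 : 'I_2) (1 : 'I_2).

Definition AGL1_stab B : {set {'GL_2[F]}} :=
  [set g in AGL1 | [set AGL1_act g x | x in B] == B].

Definition Nstab (S : {group {'GL_2[F]}}) (k : nat) : nat :=
  #|[set B : {set F} | (#|B| == k) && (AGL1_stab B == S)]|.

Definition Hbar H : {set {'GL_2[F]}} := [set affine 1%g h | h in H].

Definition Sabh a b H : {group {'GL_2[F]}} :=
  <<affine a b |: Hbar H>>%G.

Lemma affine_AGL1 a b : affine a b \in AGL1.
Proof. by rewrite inE !mxE !eqxx. Qed.

Lemma AGL1_act_affine a b x : AGL1_act (affine a b) x = val a * x + b.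
Proof. by rewrite /AGL1_act !mxE. Qed.

Lemma Sabh_sub a b H : Sabh a b H \subset AGL1.
Proof.
rewrite gen_subG subUset sub1set affine_AGL1.
by apply/subsetP => _ /imsetP[h _ ->]; apply: affine_AGL1.
Qed.

Definition Hprime H : {set F} := [set x | [set x * h | h in H] \subset H].

Section Triples.

Variables (p : nat) (pcharFp : p \in [pchar F]).

(* pPrimeCharType pcharFp is F seen as an extension of the prime field 'F_p *)
Definition Fp_adjoin a : {subfield pPrimeCharType pcharFp} :=
  <<1; (val a : pPrimeCharType pcharFp)>>%AS.

Definition is_subspace (K : {subfield pPrimeCharType pcharFp}) H : Prop :=
  0 \in H /\
  forall c x y : F, (c : pPrimeCharType pcharFp) \in K ->
    x \in H -> y \in H -> c * x + y \in H.

Definition in_S a b H : Prop :=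
  is_subspace (Fp_adjoin a) H /\ (a = 1%g -> b = 0).

End Triples.

End AGL.

(* Equal to the multiplicative order of v modulo u when u > 0 and v is coprime
   to u, including u = 1, where 'Z_1 is 'Z_2 and the order is 1 (the value
   when v is even being the order of the default element 1). *)
Definition ord_mod (u v : nat) : nat :=
  #[insubd (1%g : {unit 'Z_u}) (v%:R : 'Z_u)]%g.

Lemma ord_modP (u v n : nat) : (0 < u)%N -> coprime u v ->
  (v ^ n == 1 %[mod u])%N = (ord_mod u v %| n)%N.
Proof.
case: u => [|[|u]] // _ cuv.
  rewrite !modn1 eqxx.
  have e1 (x : {unit 'Z_1}) : x = 1%g.
    apply/val_inj; case: x => x /= ux; apply/val_inj.
    have : x != 0 by apply: contraTneq ux => ->; rewrite unitr0.
    by case: x {ux} => [[|[|]]].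
  by rewrite /ord_mod [insubd _ _]e1 order1 dvd1n.
rewrite /ord_mod order_dvdn -(inj_eq val_inj) FinRing.val_unitX.
rewrite val_insubd unitZpE // cuv FinRing.val_unit1 -natrX.
by rewrite -(inj_eq val_inj) /= !val_Zp_nat // ?Zp_nat.
Qed.

(* x may be a nonintegral rational. *)
Definition rbinom (x y : rat) : rat :=
  if y \is a Num.nat then
    (\prod_(i < Num.truncn y) (x - i%:R)) / (Num.truncn y)`!%:R
  else 0.

Lemma rbinom_nat (m n : nat) : rbinom m%:R n%:R = 'C(m, n)%:R.
Proof.
rewrite /rbinom natr_nat natrK.
have e : \prod_(i < n) (m%:R - i%:R : rat) = (m ^_ n)%:R.
  elim: n => [|n IHn]; first by rewrite big_ord0.
  rewrite big_ord_recr /= IHn ffactnSr natrM.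
  have [lenm|ltmn] := leqP n m; first by rewrite natrB.
  by rewrite ffact_small // !mul0r.
by rewrite e -bin_ffact natrM mulfK // pnatr_eq0 -lt0n fact_gt0.
Qed.

Definition s_qk (q k u v : nat) : rat :=
  rbinom ((q%:R - v%:R) / (u * v)%:R) (k%:R / (u * v)%:R)
  + rbinom ((q%:R - v%:R) / (u * v)%:R) ((k%:R - v%:R) / (u * v)%:R).

(* The truncated n - i is harmless: for n < m the factor i = n is already 0. *)
Definition gauss_binom (Q : rat) (n m : nat) : rat :=
  \prod_(i < m) ((1 - Q ^+ (n - i)) / (1 - Q ^+ i.+1)).

(* Sets of prime divisors of n, as sets of naturals at most n. *)
Definition prime_divisors (n : nat) : {set 'I_n.+1} :=
  [set e : 'I_n.+1 | (e : nat) \in primes n].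

Definition setprod (n : nat) (P : {set 'I_n}) : nat :=
  (\prod_(e in P) (e : nat))%N.

(* Main.v *)
Require Import Defs.
From HB Require Import structures.
From mathcomp Require Import all_boot all_order all_fingroup all_algebra.
From mathcomp Require Import all_solvable all_field.
From mathcomp Require Import ring.

Import Order.TTheory GRing.Theory Num.Theory.

Local Open Scope ring_scope.

(** Write M(B) for the group of scalars c with c B = B and T(B) for the additive
    group of translations preserving B. Let a be a scalar of order d > 1 with
    a H = H. The stabilizer of B is S(a, 0, H) exactly when M(B) = <a> and
    T(B) = H ([AGL1_stab_eq_Sabh]): the commutator of x |-> c x + b with
    x |-> a x is a translation by (1 - a) b, so a stabilizer containing
    x |-> a x splits into its scalars and its translations.

    The formula is an inclusion-exclusion over the pairs (U, G) where U is a
    group of scalars, with <a> <= U and U H = H, and G is an additive group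
    containing H and stable under U. Such a G is a vector space over the field
    K generated by U, which has Q = p ^ o elements, o being the order of p
    modulo u = #|U| ([card_scal_span]).

    - The subsets of size k with U <= M(B) and G <= T(B) are the unions of
      orbits of the maps x |-> c x + g. One orbit is G, all others have
      u * #|G| elements, so there are s_qk q k u #|G| of these subsets
      ([card_invariant_sets]).
    - The number of G of dimension l over H inside a given space of dimension r
      over H is the Gaussian binomial coefficient of r and l
      ([card_subspaces_between]).
    - Fix U and B with U <= M(B). Then U stabilizes T(B), and the alternating
      sum over the G between H and T(B), weighted by (-1) ^ l * Q ^ 'C(l, 2),
      is 1 if T(B) = H and 0 otherwise, by the q-binomial identity
      ([gauss_alternating], [subspaces_mobius]). Hence the inner sum of the
      formula counts the B of size k with U <= M(B) and T(B) = H
      ([count_transl_stab]).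
    - For such a B, M(B) is contained in M(H), which is cyclic of order
      #|H'| - 1. With U running over the subgroups of M(H) of order d * prod P,
      the sum of (-1) ^ #|P| over the P with U <= M(B) is the alternating sum
      over the sets of primes dividing #|M(B)| / d, which is 1 if #|M(B)| = d
      and 0 otherwise ([alternating_prime_divisors]). Subgroups of a cyclic
      group being determined by their order, #|M(B)| = d means M(B) = <a>. *)

Set Implicit Arguments.
Unset Strict Implicit.
Unset Printing Implicit Defensive.

(** * Scalars and translations preserving a set *)

Section Stabilizers.

Variable F : finFieldType.
Implicit Types (B : {set F}) (G W : {group F}) (U : {group {unit F}}).

(** Inclusion in [B] rather than equality with [B]: the two agree because the
    maps are injective and [B] is finite. *)
Definition scal_stab B : {set {unit F}} :=
  [set c : {unit F} | [forall x in B, val c * x \in B]].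

Definition transl_stab B : {set F} :=
  [set h : F | [forall x in B, h + x \in B]].

Lemma scal_stabP B (c : {unit F}) :
  reflect {in B, forall x, val c * x \in B} (c \in scal_stab B).
Proof. by rewrite inE; apply: (iffP forall_inP). Qed.

Lemma transl_stabP B h :
  reflect {in B, forall x, h + x \in B} (h \in transl_stab B).
Proof. by rewrite inE; apply: (iffP forall_inP). Qed.

Lemma scal_stab_group_set B : group_set (scal_stab B).
Proof.
apply/group_setP; split=> [|c c' /scal_stabP cP /scal_stabP c'P].
  by apply/scal_stabP => x; rewrite mul1r.
by apply/scal_stabP => x /c'P /cP; rewrite mulrA.
Qed.

Canonical scal_stab_group B := Group (scal_stab_group_set B).

Lemma transl_stab_group_set B : group_set (transl_stab B).
Proof.
apply/group_setP; split=> [|c c' /transl_stabP cP /transl_stabP c'P].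
  by apply/transl_stabP => x; rewrite add0r.
by apply/transl_stabP => x /c'P /cP; rewrite addrA.
Qed.

Canonical transl_stab_group B := Group (transl_stab_group_set B).

Lemma addgroup0 G : 0 \in G. Proof. exact: group1. Qed.
Lemma addgroupD G : {in G &, forall x y, x + y \in G}.
Proof. exact: groupM. Qed.
Lemma addgroupN G : {in G, forall x, - x \in G}.
Proof. by move=> x; rewrite -FinRing.zmodVgE groupV. Qed.
Lemma addgroupB G : {in G &, forall x y, x - y \in G}.
Proof. by move=> x y Gx Gy; rewrite addgroupD // addgroupN. Qed.

(** An injective map of a finite set into itself is onto, so a
    nonzero scalar preserving [B] can be cancelled. *)
Lemma scal_cancel B (t y : F) :
  t != 0 -> {in B, forall x, t * x \in B} -> t * y \in B -> y \in B.
Proof.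
move=> t0 tB tyB; have injt : injective ( *%R t) by exact: mulfI.
have: t * y \in [set t * x | x in B].
  suff -> : [set t * x | x in B] = B by [].
  apply/eqP; rewrite eqEcard card_imset // leqnn andbT.
  by apply/subsetP => _ /imsetP[x xB ->]; apply: tB.
by case/imsetP => x xB /injt ->.
Qed.

Lemma transl_cancel B (h y : F) :
  h \in transl_stab B -> h + y \in B -> y \in B.
Proof.
move=> hB hyB; have /transl_stabP/(_ _ hyB) : - h \in transl_stab_group B.
  exact: addgroupN.
by rewrite addKr.
Qed.

(** If [c B = B] then [c (B + h) = B + c h], so dilations preserving [B]
    permute the translations preserving [B]. *)
Lemma scal_stab_transl B : scal_stab B \subset scal_stab (transl_stab B).
Proof.
apply/subsetP => c cB; apply/scal_stabP => h /transl_stabP hB.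
apply/transl_stabP => x xB.
have /scal_stabP c'B : c^-1%g \in scal_stab_group B by rewrite groupV.
have := (scal_stabP _ _ cB) _ (hB _ (c'B _ xB)).
by rewrite mulrDr mulrA -FinRing.val_unitM mulgV mul1r.
Qed.

(** The difference of two scalars preserving an additive group preserves it
    too. *)
Lemma scal_stab_sub G (c c' : {unit F}) y :
  c \in scal_stab G -> c' \in scal_stab G -> c != c' ->
  (val c - val c') * y \in G -> y \in G.
Proof.
move=> /scal_stabP cG /scal_stabP c'G ncc'; apply: scal_cancel.
  by rewrite subr_eq0 (inj_eq val_inj).
by move=> x xG; rewrite mulrBl addgroupB ?cG ?c'G.
Qed.

(** The additive span of a group of scalars is closed under products, hence is
    the subfield generated by [U]. Additive subgroups of [F] are groups in the
    sense of finite group theory, so that Lagrange's theorem applies to them. *)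
Definition scal_span U : {group F} := <<[set val c | c in U]>>%G.

Lemma scal_span_sub U G :
  (forall c, c \in U -> val c \in G) -> scal_span U \subset G.
Proof.
move=> UG; rewrite gen_subG; apply/subsetP => _ /imsetP[c cU ->].
exact: UG.
Qed.

Lemma mem_scal_span U c : c \in U -> val c \in scal_span U.
Proof. by move=> cU; apply: mem_gen; apply: imset_f. Qed.

Lemma scal_span1 U : 1 \in scal_span U.
Proof. by rewrite -[1]/(val (1%g : {unit F})) mem_scal_span. Qed.

Lemma card_scal_span_gt1 U : (1 < #|scal_span U|)%N.
Proof.
rewrite (cardD1 0) group1 (cardD1 1) /= inE /= oner_eq0.
by rewrite scal_span1.
Qed.

(** A [U]-stable additive group is a vector space over [scal_span U]. *)
Lemma scal_span_mul U G : U \subset scal_stab G ->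
  {in scal_span U & G, forall x g, x * g \in G}.
Proof.
move=> UG x g xK gG.
have ES : group_set [set x | x * g \in G].
  apply/group_setP; split=> [|a b]; rewrite !inE ?mul0r ?addgroup0 // mulrDl.
  exact: addgroupD.
have /subsetP/(_ _ xK) : scal_span U \subset Group ES; last by rewrite inE.
by apply: scal_span_sub => c /(subsetP UG)/scal_stabP cG; rewrite inE cG.
Qed.

Lemma scal_stab_span U : U \subset scal_stab (scal_span U).
Proof.
apply/subsetP => c cU; apply/scal_stabP => x xK.
have ES : group_set [set x | val c * x \in scal_span U].
  apply/group_setP; split=> [|a b]; rewrite !inE ?mulr0 ?addgroup0 // mulrDr.
  exact: addgroupD.
have /subsetP/(_ _ xK) : scal_span U \subset Group ES; last by rewrite inE.
apply: scal_span_sub => c' c'U.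
by rewrite inE -FinRing.val_unitM mem_scal_span ?groupM.
Qed.

Lemma card_units_in (A : {set F}) :
  #|[set c : {unit F} | val c \in A]| = #|A :\ 0|.
Proof.
rewrite -(card_imset _ val_inj); apply: eq_card => x; rewrite !inE.
apply/imsetP/andP => [[c /[!inE] cA ->]|[x0 xA]].
  by split=> //; rewrite -unitfE (valP c).
have ux : x \is a GRing.unit by rewrite unitfE.
by exists (FinRing.unit F ux); rewrite ?inE.
Qed.

Lemma card_Hprime B : 0 \in B -> #|Hprime B| = #|scal_stab B|.+1.
Proof.
move=> B0; have H'0 : 0 \in Hprime B.
  by rewrite inE; apply/subsetP => _ /imsetP[x _ ->]; rewrite mul0r.
rewrite (cardsD1 0) H'0 -card_units_in add1n; congr _.+1.
apply: eq_card => c; rewrite !inE; apply/subsetP/forall_inP => cB x.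
  by move=> xB; apply: cB; apply: imset_f.
by case/imsetP=> y yB ->; apply: cB.
Qed.

(** Let [p ^ m] be the size of the span [K]. Since [U] is a subgroup of the
    units of [K], [#|U|] divides [p ^ m - 1], so the order [o] of [p] divides
    [m]. Conversely each element of [U], hence of [K], is fixed by the [o]-th
    power of the Frobenius map, and so is a root of a polynomial of degree
    [p ^ o]. *)
Lemma card_scal_span U (p alpha : nat) : prime p -> #|F| = (p ^ alpha)%N ->
  #|scal_span U| = (p ^ ord_mod #|U| p)%N.
Proof.
move=> prime_p cardF; set K := scal_span U; set o := ord_mod _ _.
have pcharFp : p \in [pchar F] := card_finPcharP cardF prime_p.
have alpha_gt0 : (0 < alpha)%N.
  by have := finNzRing_gt1 F; rewrite cardF; case: (alpha).
have cUp : coprime #|U| p.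
  have : (#|U| %| (p ^ alpha).-1)%N.
    by rewrite -cardF -card_finField_unit cardSg ?subsetT.
  rewrite -(prednK alpha_gt0) => /coprime_dvdl; apply.
  rewrite -(@coprime_pexpr alpha) // prednK // coprime_sym.
  by rewrite coprimenP // expn_gt0 prime_gt0.
have [m _ cardK] : exists2 m, (m <= alpha)%N & #|K| = (p ^ m)%N.
  by apply/dvdn_pfactor; rewrite // -cardF -cardsT cardSg ?subsetT.
have K_gt1 : (1 < #|K|)%N := card_scal_span_gt1 U.
have o_dvd_m : (o %| m)%N.
  rewrite -ord_modP // -cardK eqn_mod_dvd ?(ltnW K_gt1) // subn1.
  have KE : group_set [set c : {unit F} | val c \in K].
    apply/group_setP; split=> [|c c']; rewrite !inE ?scal_span1 // => cK c'K.
    by rewrite (scal_span_mul (scal_stab_span U)).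
  have -> : #|K|.-1 = #|Group KE|.
    by rewrite card_units_in (cardsD1 0 K) group1.
  by apply: cardSg; apply/subsetP => c cU; rewrite inE mem_scal_span.
have m_gt0 : (0 < m)%N by move: K_gt1; rewrite cardK; case: (m).
have o_gt0 : (0 < o)%N := dvdn_gt0 m_gt0 o_dvd_m.
have po_gt1 : (1 < p ^ o)%N by rewrite -{1}(exp1n o) ltn_exp2r ?prime_gt1.
suff le_K : (#|K| <= p ^ o)%N.
  apply/eqP; rewrite eqn_leq le_K cardK leq_exp2l ?prime_gt1 //.
  exact: dvdn_leq.
have frobE : group_set [set x : F | x ^+ (p ^ o) == x].
  apply/group_setP; split=> [|x y]; rewrite !inE.
    by rewrite expr0n eqn0Ngt expn_gt0 prime_gt0.
  move=> /eqP xE /eqP yE; rewrite exprDn_pchar ?xE ?yE //.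
  by rewrite (eq_pnat _ (pcharf_eq pcharFp)) pnatX pnat_id.
have sub : K \subset Group frobE.
  apply: scal_span_sub => c cU; rewrite inE -FinRing.val_unitX.
  rewrite (inj_eq val_inj) -(prednK (ltnW po_gt1)) expgS.
  rewrite -subn1; have /eqP := expg_cardG cU.
  have : (#|U| %| p ^ o - 1)%N.
    by rewrite -eqn_mod_dvd ?(ltnW po_gt1) // ord_modP // dvdnn.
  by case/dvdnP => j -> /eqP cU1; rewrite mulnC expgM cU1 expg1n mulg1.
apply: leq_trans (subset_leq_card sub) _.
have szP : size ('X^(p ^ o) - 'X : {poly F}) = (p ^ o).+1.
  by rewrite size_polyDl ?size_polyXn // size_polyN size_polyX ltnS.
rewrite -ltnS -szP cardE; apply: max_poly_roots; rewrite ?enum_uniq //.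
  by rewrite -size_poly_eq0 szP.
by apply/allP => x; rewrite mem_enum inE rootE !hornerE subr_eq0.
Qed.

End Stabilizers.

(** * Alternating sums of Gaussian binomial coefficients *)

Section GaussBinomial.

Variable Q : rat.
Hypothesis Q_gt1 : 1 < Q.

Lemma gauss_den_neq0 n : 1 - Q ^+ n.+1 != 0.
Proof. by rewrite subr_eq0 eq_sym gt_eqF // exprn_egt1. Qed.

Lemma gauss_binom0 n : gauss_binom Q n 0 = 1.
Proof. by rewrite /gauss_binom big_ord0. Qed.

Lemma gauss_binom_small n m : (n < m)%N -> gauss_binom Q n m = 0.
Proof.
move=> ltnm; rewrite /gauss_binom (bigD1 (Ordinal ltnm)) //=.
by rewrite subnn expr0 subrr !mul0r.
Qed.

Lemma gauss_binomS n m :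
  (1 - Q ^+ m.+1) * gauss_binom Q n m.+1
  = (1 - Q ^+ (n - m)) * gauss_binom Q n m.
Proof.
rewrite /gauss_binom big_ord_recr /=.
by field; apply: gauss_den_neq0.
Qed.

(** The q-analogue of [(m + 1) 'C(n + 1, m + 1) = (n + 1) 'C(n, m)], and the
    recursion which double counting yields for the number of subspaces. *)
Lemma gauss_binom_absorb n m :
  (1 - Q ^+ m.+1) * gauss_binom Q n.+1 m.+1
  = (1 - Q ^+ n.+1) * gauss_binom Q n m.
Proof.
rewrite /gauss_binom !big_split /= !prodfV.
rewrite [in LHS]big_ord_recl [in X in _ * (_ / X)]big_ord_recr /=.
have den0 : \prod_(i < m) (1 - Q ^+ i.+1) != 0.
  by apply/prodf_neq0 => i _; exact: gauss_den_neq0.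
under eq_bigr do rewrite subSS.
by field; rewrite gauss_den_neq0 den0.
Qed.

Lemma gauss_binom_pascal n m :
  gauss_binom Q n.+1 m.+1
  = gauss_binom Q n m + Q ^+ m.+1 * gauss_binom Q n m.+1.
Proof.
apply: (mulfI (gauss_den_neq0 m)).
rewrite gauss_binom_absorb mulrDr mulrCA gauss_binomS mulrA -mulrDl.
have [lemn|ltnm] := leqP m n; last by rewrite gauss_binom_small ?mulr0.
congr (_ * _); have -> : n.+1 = (m.+1 + (n - m))%N by rewrite addSn subnKC.
by rewrite exprD; ring.
Qed.

(** By the Pascal rule the terms telescope. *)
Lemma gauss_alternating_partial r n :
  \sum_(0 <= l < n.+1) (-1) ^+ l * Q ^+ 'C(l, 2) * gauss_binom Q r.+1 l
  = (-1) ^+ n * Q ^+ 'C(n.+1, 2) * gauss_binom Q r n.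
Proof.
elim: n => [|n IHn]; first by rewrite big_nat1 !gauss_binom0.
rewrite big_nat_recr //= IHn gauss_binom_pascal [in RHS]binS bin1 exprD.
by rewrite exprS; ring.
Qed.

Lemma gauss_alternating r n : (r <= n)%N ->
  \sum_(0 <= l < n.+1) (-1) ^+ l * Q ^+ 'C(l, 2) * gauss_binom Q r l
  = (r == 0%N)%:R.
Proof.
case: r => [|r] lern.
  rewrite big_nat_recl //= gauss_binom0 big1_seq ?addr0 // => l _.
  by rewrite gauss_binom_small ?mulr0.
by rewrite gauss_alternating_partial gauss_binom_small ?mulr0.
Qed.

End GaussBinomial.

(** * Counting stable additive groups *)

Section Subspaces.

Variables (F : finFieldType) (U : {group {unit F}}).
Implicit Types (G W : {group F}).

Local Notation K := (scal_span U).
Local Notation Q := #|scal_span U|.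
Local Notation stable G := (U \subset scal_stab G).

(** The [K]-space [G + K x]. *)
Definition subspace_adjoin G (x : F) : {set F} :=
  [set u.1 + u.2 * x | u in setX G K].

Lemma subspace_adjoin_group_set G x : group_set (subspace_adjoin G x).
Proof.
apply/group_setP; split=> [|y z].
  by apply/imsetP; exists (0, 0); rewrite ?in_setX ?addgroup0 //= mul0r addr0.
case/imsetP=> -[g1 k1] /setXP[/= Gg1 Kk1] ->.
case/imsetP=> -[g2 k2] /setXP[/= Gg2 Kk2] ->.
apply/imsetP; exists (g1 + g2, k1 + k2); rewrite ?in_setX ?addgroupD //=.
by rewrite FinRing.zmodMgE mulrDl addrACA.
Qed.

Canonical subspace_adjoin_group G x := Group (subspace_adjoin_group_set G x).

Lemma sub_subspace_adjoin G x : G \subset subspace_adjoin G x.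
Proof.
apply/subsetP => g gG; apply/imsetP; exists (g, 0).
  by rewrite in_setX gG addgroup0.
by rewrite /= mul0r addr0.
Qed.

Lemma mem_subspace_adjoin G x : x \in subspace_adjoin G x.
Proof.
apply/imsetP; exists (0, 1); first by rewrite in_setX addgroup0 scal_span1.
by rewrite /= mul1r add0r.
Qed.

Lemma subspace_adjoin_sub G W x : stable W ->
  (subspace_adjoin G x \subset W) = (G \subset W) && (x \in W).
Proof.
move=> stW; apply/idP/andP => [sub|[sub xW]].
  split; first exact: subset_trans (sub_subspace_adjoin G x) sub.
  by rewrite (subsetP sub) ?mem_subspace_adjoin.
apply/subsetP => _ /imsetP[[g k] /setXP[/= Gg Kk] ->].
by apply: addgroupD; [apply: (subsetP sub) | apply: (scal_span_mul stW)].
Qed.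

Lemma scal_stab_adjoin G x : stable G -> stable (subspace_adjoin G x).
Proof.
move=> /subsetP stG; apply/subsetP => c cU; apply/scal_stabP.
move=> _ /imsetP[[g k] /setXP[/= Gg Kk] ->].
apply/imsetP; exists (val c * g, val c * k); rewrite ?in_setX /=.
  apply/andP; split; first exact: (scal_stabP _ _ (stG c cU)).
  exact: (scal_stabP _ _ (subsetP (scal_stab_span U) c cU)).
by rewrite mulrDr mulrA.
Qed.

Lemma card_subspace_adjoin G x : stable G -> x \notin G ->
  #|subspace_adjoin G x| = (#|G| * Q)%N.
Proof.
move=> stG xG; rewrite card_in_imset ?cardsX //.
move=> [g k] [g' k'] /setXP[/= Gg Kk] /setXP[/= Gg' Kk'] eq.
have [kk'|nkk'] := eqVneq k k'.
  by rewrite -kk' in eq *; rewrite (addIr _ eq).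
case/negP: xG; apply: (@scal_cancel _ G (k - k')); first by rewrite subr_eq0.
  by move=> z Gz; rewrite (scal_span_mul stG) ?addgroupB.
have -> : (k - k') * x = g' - g.
  by rewrite mulrBl; apply/eqP; rewrite subr_eq addrAC -eq addrAC subrr add0r.
exact: addgroupB.
Qed.

(** Adjoining one vector at a time multiplies the size by [Q]. *)
Lemma card_subspace G W : stable G -> stable W -> G \subset W ->
  {r | #|W| = (#|G| * Q ^ r)%N}.
Proof.
move=> stG stW; have [n] := ubnP (#|W| - #|G|); elim: n G stG => // n IHn G stG.
move=> ltn subGW; have [/eqP eqGW|] := boolP (G == W :> {set F}).
  by exists 0%N; rewrite eqGW expn0 muln1.
rewrite eqEproper subGW negb_and /= negbK => /properP[_ /sig2W[x xW xG]].
have subxW : subspace_adjoin G x \subset W.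
  by rewrite subspace_adjoin_sub ?subGW.
have cardx := card_subspace_adjoin stG xG.
have ltGx : (#|G| < #|subspace_adjoin G x|)%N.
  by rewrite cardx ltn_Pmulr ?cardG_gt0 ?card_scal_span_gt1.
have lexW := subset_leq_card subxW.
have [|r] := IHn (subspace_adjoin_group G x) (scal_stab_adjoin x stG) _ subxW.
  rewrite -ltnS; apply: leq_trans ltn; rewrite ltnS; apply: ltn_sub2l => //.
  exact: leq_trans ltGx lexW.
by rewrite /= cardx -mulnA -expnS => ->; exists r.+1.
Qed.

(** The exponent [l] is the dimension of [G1 / G] over [K]. *)
Definition subspaces_between G W l : {set {group F}} :=
  [set G1 : {group F} |
    [&& G \subset G1, G1 \subset W, stable G1 & #|G1| == (#|G| * Q ^ l)%N]].

(** Double counting of the pairs [(G1, x)] with [x] in [G1 \ G]: adjoining [x]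
    to [G] turns these into the subspaces between [G + K x] and [W], of one
    dimension less. *)
Lemma card_subspaces_between G W r l : stable G -> stable W -> G \subset W ->
  #|W| = (#|G| * Q ^ r)%N ->
  #|subspaces_between G W l|%:R = gauss_binom Q%:R r l :> rat.
Proof.
have Q_gt1 : (1 : rat) < Q%:R by rewrite ltr1n card_scal_span_gt1.
move=> stG stW; elim: l r G stG => [|l IHl] r G stG subGW cardW.
  rewrite gauss_binom0; have -> : subspaces_between G W 0 = [set G].
    apply/setP => G1; rewrite !inE expn0 muln1; apply/idP/eqP => [|->].
      case/and4P=> sGG1 _ _ /eqP cardG1; apply/esym/val_inj/eqP.
      by rewrite eqEcard sGG1 cardG1 /=.
    by rewrite subxx subGW stG eqxx.
  by rewrite cards1.
have G_neq0 : (#|G|%:R : rat) != 0 by rewrite pnatr_eq0 -lt0n cardG_gt0.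
apply: (mulfI (gauss_den_neq0 Q_gt1 l)); apply: (mulfI G_neq0).
transitivity (- (\sum_(G1 in subspaces_between G W l.+1) #|G1 :\: G|)%:R : rat).
  rewrite (eq_bigr (fun=> (#|G| * Q ^ l.+1 - #|G|)%N)) => [|G1].
    rewrite sum_nat_const natrM natrB ?leq_pmulr ?expn_gt0 ?cardG_gt0 //.
    by rewrite natrM natrX; ring.
  rewrite inE => /and4P[sGG1 _ _ /eqP cardG1].
  by rewrite cardsD (setIidPr sGG1) cardG1.
have -> : (\sum_(G1 in subspaces_between G W l.+1) #|G1 :\: G| =
  \sum_(x in W :\: G) #|subspaces_between (subspace_adjoin_group G x) W l|)%N.
  under eq_bigr do rewrite -sum1_card.
  under [RHS]eq_bigr do rewrite -sum1_card.
  rewrite (exchange_big_dep (mem (W :\: G))) /= => [|G1 x]; last first.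
    by rewrite !inE => /and4P[_ /subsetP sG1W _ _] /andP[-> /sG1W].
  apply: eq_bigr => x; rewrite !inE => /andP[xG xW]; apply: eq_bigl => G1.
  rewrite !inE xG /= card_subspace_adjoin // expnS mulnA.
  have [stG1|] := boolP (stable G1); last by rewrite !andbF.
  rewrite subspace_adjoin_sub //.
  by do !case: (_ \subset _); rewrite ?andbF ?andbT // andbC.
rewrite natr_sum; case: r cardW => [|r] cardW.
  have -> : W :\: G = set0.
    apply/eqP; rewrite -subset0 subDset setU0.
    suff /eqP <- : (G : {set F}) == W by rewrite subxx.
    by rewrite eqEcard subGW cardW expn0 muln1 /=.
  by rewrite big_set0 gauss_binomS // sub0n expr0 subrr mul0r mulr0 oppr0.
rewrite (eq_bigr (fun=> gauss_binom Q%:R r l)) => [|x /[!inE] /andP[xG xW]].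
  rewrite sumr_const cardsD (setIidPr subGW) cardW.
  rewrite -[gauss_binom _ _ _ *+ _]mulr_natl natrB; last first.
    by rewrite leq_pmulr ?expn_gt0 ?(ltnW (card_scal_span_gt1 U)).
  by rewrite gauss_binom_absorb // natrM natrX; ring.
apply: IHl; rewrite ?scal_stab_adjoin ?subspace_adjoin_sub ?subGW //=.
by rewrite card_subspace_adjoin // cardW expnS mulnA.
Qed.



(** The Moebius function of the lattice of subspaces sums to zero over a
    nontrivial interval. Taking [l] up to the codimension of [G] in [F] makes
    the range of summation independent of [W]. *)
Lemma subspaces_mobius G W n : stable G -> stable W ->
  #|F| = (#|G| * Q ^ n)%N ->
  \sum_(0 <= l < n.+1)
    (-1) ^+ l * Q%:R ^+ 'C(l, 2) * #|subspaces_between G W l|%:R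
  = (G == W :> {set F})%:R :> rat.
Proof.
move=> stG stW cardF; have [sGW|nsGW] := boolP (G \subset W); last first.
  rewrite big1_seq => [|l _].
    by rewrite eqEsubset (negPf nsGW).
  have -> : subspaces_between G W l = set0; last by rewrite cards0 mulr0.
  apply/setP => G1; rewrite !inE; apply/and4P => -[sGG1 sG1W _ _].
  by rewrite (subset_trans sGG1) in nsGW.
have [r cardW] := card_subspace stG stW sGW.
under eq_bigr do rewrite (card_subspaces_between _ stG stW sGW cardW).
have Q_gt1 := card_scal_span_gt1 U.
rewrite gauss_alternating ?ltr1n //; last first.
  rewrite -(leq_exp2l _ _ Q_gt1) -(leq_pmul2l (cardG_gt0 G)) -cardW -cardF.
  exact: max_card.
congr (nat_of_bool _)%:R; rewrite eqEcard sGW cardW /=.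
rewrite -{2}[#|G|]muln1 leq_pmul2l ?cardG_gt0 //.
by rewrite -{2}(expn0 Q) leq_exp2l // leqn0.
Qed.

End Subspaces.

(** * Counting invariant subsets *)

Lemma rbinom_ratio N j w : (0 < w)%N ->
  rbinom N%:R (j%:R / w%:R) = (if (w %| j)%N then 'C(N, j %/ w) else 0%N)%:R.
Proof.
move=> w_gt0; have w_neq0 : w%:R != 0 :> rat by rewrite pnatr_eq0 -lt0n.
case: ifPn => [/dvdnP[i ->]|ndvd].
  by rewrite mulnK // natrM mulfK // rbinom_nat.
rewrite /rbinom; case: ifP => // /natrP[i eq]; case/dvdnP: ndvd; exists i.
by apply/eqP; rewrite -(eqr_nat rat) natrM -eq divfK.
Qed.

Lemma rbinom_neg x y : y < 0 -> rbinom x y = 0.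
Proof.
move=> y_lt0; rewrite /rbinom; case: ifP => // /natr_ge0.
by rewrite leNgt y_lt0.
Qed.

Section InvariantSets.

Variables (F : finFieldType) (U : {group {unit F}}) (G : {group F}).
Hypothesis stG : U \subset scal_stab G.

Definition aff_orbit (y : F) : {set F} :=
  [set val u.1 * y + u.2 | u in setX U G].

Lemma mem_aff_orbit y : y \in aff_orbit y.
Proof.
apply/imsetP; exists (1%g, 0); rewrite ?in_setX ?addgroup0 ?group1 //=.
by rewrite mul1r addr0.
Qed.

Lemma aff_orbit_sub y z : z \in aff_orbit y -> aff_orbit z \subset aff_orbit y.
Proof.
case/imsetP => -[c g] /setXP[/= cU Gg] ->.
apply/subsetP => _ /imsetP[[c' g'] /setXP[/= c'U Gg'] ->].
apply/imsetP; exists ((c' * c)%g, val c' * g + g').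
  rewrite in_setX groupM //= addgroupD //.
  exact: (scal_stabP _ _ (subsetP stG c' c'U)).
by rewrite /= mulrDr mulrA addrA.
Qed.

Lemma aff_orbit_sym y z : z \in aff_orbit y -> y \in aff_orbit z.
Proof.
case/imsetP => -[c g] /setXP[/= cU Gg] ->.
have cVU : c^-1%g \in U by rewrite groupV.
apply/imsetP; exists (c^-1%g, - (val c^-1%g * g)).
  by rewrite in_setX cVU addgroupN // (scal_stabP _ _ (subsetP stG _ cVU)).
have cVK : val c^-1%g * (val c * y) = y.
  by rewrite mulrA -FinRing.val_unitM mulVg mul1r.
by rewrite /= mulrDr addrK cVK.
Qed.

Lemma aff_orbit_eq y z : z \in aff_orbit y -> aff_orbit z = aff_orbit y.
Proof.
move=> yz; apply/eqP; rewrite eqEsubset aff_orbit_sub //=.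
by rewrite aff_orbit_sub // aff_orbit_sym.
Qed.

(** Off its fixed coset [G] the group of maps [c x + g] acts freely: if two
    of them agree at [y], a difference of two scalars sends [y] into [G]. *)
Lemma card_aff_orbit y : y \notin G -> #|aff_orbit y| = (#|U| * #|G|)%N.
Proof.
move=> yG; rewrite card_in_imset ?cardsX //.
move=> [c g] [c' g'] /setXP[/= cU Gg] /setXP[/= c'U Gg'] eq.
have [cc'|ncc'] := eqVneq c c'.
  by rewrite -cc' in eq *; rewrite (addrI _ eq).
case/negP: yG; apply: (scal_stab_sub _ _ ncc'); try exact: (subsetP stG).
suff -> : (val c - val c') * y = g' - g by rewrite addgroupB.
rewrite mulrBl; move: eq => /= /(canRL (addrK g)) ->.
by rewrite addrC -addrA addKr.
Qed.

Lemma aff_orbit_compl y : y \notin G -> aff_orbit y \subset ~: G.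
Proof.
move=> yG; apply/subsetP => z yz; rewrite inE; apply: contra yG => Gz.
have /imsetP[[c g] /setXP[/= cU Gg] ->] := aff_orbit_sym yz.
by rewrite addgroupD // (scal_stabP _ _ (subsetP stG c cU)).
Qed.

Lemma invariantP (B : {set F}) :
  reflect (forall y, y \in B -> aff_orbit y \subset B)
    ((U \subset scal_stab B) && (G \subset transl_stab B)).
Proof.
apply: (iffP andP) => [[/subsetP UB /subsetP GB] y yB|sB].
  apply/subsetP => _ /imsetP[[c g] /setXP[/= cU Gg] ->].
  rewrite addrC; apply: (transl_stabP _ _ (GB g Gg)).
  exact: (scal_stabP _ _ (UB c cU)).
split.
  apply/subsetP => c cU; apply/scal_stabP => y /sB/subsetP; apply; apply/imsetP.
  by exists (c, 0); rewrite ?in_setX ?cU ?addgroup0 //= addr0.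
apply/subsetP => g Gg; apply/transl_stabP => y /sB/subsetP; apply; apply/imsetP.
by exists (1%g, g); rewrite ?in_setX ?group1 //= mul1r addrC.
Qed.

Definition free_orbits : {set {set F}} := [set aff_orbit y | y in ~: G].

Lemma free_orbits_partition : partition free_orbits (~: G).
Proof.
apply/and3P; split.
- rewrite eqEsubset; apply/andP; split.
    apply/bigcupsP => _ /imsetP[y /[!inE] yG ->]; exact: aff_orbit_compl.
  apply/subsetP => y yG; apply/bigcupP; exists (aff_orbit y).
    exact: imset_f.
  exact: mem_aff_orbit.
- apply/trivIsetP => _ _ /imsetP[y _ ->] /imsetP[z _ ->] neq.
  rewrite -setI_eq0; apply: contraR neq => /set0Pn[x /setIP[yx zx]].
  by rewrite -(aff_orbit_eq yx) -(aff_orbit_eq zx).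
- by apply/imsetP => -[y _ e0]; have := mem_aff_orbit y; rewrite -e0 inE.
Qed.

Lemma card_free_orbit :
  {in free_orbits, forall A : {set F}, #|A| = (#|U| * #|G|)%N}.
Proof. by move=> _ /imsetP[y /[!inE] yG ->]; exact: card_aff_orbit. Qed.

Lemma card_free_orbits : #|F| = (#|free_orbits| * (#|U| * #|G|) + #|G|)%N.
Proof.
rewrite -(cardsC G) addnC; congr (_ + _)%N.
exact: card_uniform_partition card_free_orbit free_orbits_partition.
Qed.

(** The invariant sets are these unions; the boolean tells whether the fixed
    coset [G] is included, which amounts to containing [0]. *)
Definition orbit_union (e : bool) (X : {set {set F}}) : {set F} :=
  (if e then G : {set F} else set0) :|: cover X.

Lemma orbit_union_inj e :
  {in [pred X : {set {set F}} | X \subset free_orbits] &,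
    injective (orbit_union e)}.
Proof.
move=> X Y /[!inE] sX sY.
suff E (Z : {set {set F}}) : Z \subset free_orbits ->
    Z = [set A in free_orbits | A \subset orbit_union e Z].
  by move=> eqXY; rewrite (E X) // (E Y) // eqXY.
move=> /subsetP sZ; apply/setP => A; rewrite inE.
apply/idP/andP => [ZA|[/imsetP[y /[!inE] yG ->]]].
  by split; [apply: sZ | apply: subsetU; rewrite bigcup_sup // orbT].
move/subsetP/(_ y (mem_aff_orbit y)); rewrite in_setU.
have -> /= : (y \in if e then G : {set F} else set0) = false.
  by case: e; rewrite ?inE ?(negPf yG).
case/bigcupP => A' ZA' A'y; have /imsetP[z _ eA'] := sZ _ ZA'.
by rewrite eA' in A'y ZA'; rewrite (aff_orbit_eq A'y).
Qed.

Lemma card_orbit_union e (X : {set {set F}}) : X \subset free_orbits ->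
  #|orbit_union e X| = (#|X| * (#|U| * #|G|) + e * #|G|)%N.
Proof.
move=> sX; have [/eqP covP trivP _] := and3P free_orbits_partition.
have covX : cover X \subset ~: G.
  by rewrite -covP; apply/bigcupsP => A XA; rewrite bigcup_sup // (subsetP sX).
rewrite /orbit_union cardsU.
have -> : (if e then G : {set F} else set0) :&: cover X = set0.
  apply/eqP; rewrite setI_eq0 disjoint_sym disjoints_subset.
  apply: subset_trans covX _; rewrite setCS; case: e => //.
  exact: sub0set.
rewrite cards0 subn0 addnC; congr (_ + _)%N; last first.
  by case: (e); rewrite ?mul1n ?cards0.
have /eqnP <- := trivIsetS sX trivP.
rewrite (eq_bigr (fun=> (#|U| * #|G|)%N)) ?sum_nat_const // => A XA.
by rewrite card_free_orbit // (subsetP sX).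
Qed.

Lemma invariant_orbit_union e :
  [set B : {set F} | [&& U \subset scal_stab B, G \subset transl_stab B
                       & (0 \in B) == e]]
  = orbit_union e @: [set X : {set {set F}} | X \subset free_orbits].
Proof.
have [/eqP covP trivP _] := and3P free_orbits_partition.
apply/setP => B; rewrite inE andbA; apply/andP/imsetP.
  move=> [/invariantP invB /eqP B0].
  exists [set A in free_orbits | A \subset B].
    by rewrite inE setIdE subsetIl.
  have GB : forall y, y \in G -> (y \in B) = e.
    have G_orbit0 z : z \in G -> z \in aff_orbit 0.
      move=> Gz; apply/imsetP.
      by exists (1%g, z); rewrite ?in_setX ?group1 //= mulr0 add0r.
    move=> y Gy; rewrite -B0; apply/idP/idP => [By|B0'].
      by apply: (subsetP (invB _ By)); apply/aff_orbit_sym/G_orbit0.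
    by apply: (subsetP (invB _ B0')); apply: G_orbit0.
  apply/setP => y; rewrite in_setU.
  have [Gy|yG] := boolP (y \in G).
    rewrite GB //; case: (e); rewrite ?Gy // inE; apply/esym/negP.
    case/bigcupP => A /setIdP[/imsetP[z /[!inE] zG ->] _].
    by move/(subsetP (aff_orbit_compl zG)); rewrite inE Gy.
  have -> /= : (y \in if e then G : {set F} else set0) = false.
    by case: (e); rewrite ?inE ?(negPf yG).
  apply/idP/bigcupP => [By|[A /setIdP[_ /subsetP]]]; last by apply.
  exists (aff_orbit y); last exact: mem_aff_orbit.
  by rewrite inE invB // imset_f // inE.
case=> X /[!inE] sX ->; split.
  apply/invariantP => y /setUP[|/bigcupP[A XA Ay]].
    case: (e); rewrite ?inE // => Gy; apply: subsetU; apply/orP; left.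
    apply/subsetP => _ /imsetP[[c g] /setXP[/= cU Gg] ->].
    by rewrite addgroupD // (scal_stabP _ _ (subsetP stG c cU)).
  have /imsetP[z _ eA] := subsetP sX _ XA.
  rewrite eA in Ay XA; rewrite (aff_orbit_eq Ay).
  by apply: subsetU; rewrite (bigcup_sup (aff_orbit z)) ?orbT.
have -> : (0 \in orbit_union e X) = e; last exact: eqxx.
rewrite in_setU; case: (e); rewrite ?addgroup0 //= inE /=; apply/negP.
case/bigcupP => A /(subsetP sX)/imsetP[z /[!inE] zG ->].
by move/(subsetP (aff_orbit_compl zG)); rewrite inE addgroup0.
Qed.

(** The two summands of [s_qk] count the invariant sets avoiding, resp.
    containing, [0]. *)
Lemma card_invariant_sets k :
  #|[set B : {set F} | [&& #|B| == k, U \subset scal_stab B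
                         & G \subset transl_stab B]]|%:R
  = s_qk #|F| k #|U| #|G|.
Proof.
set w := (#|U| * #|G|)%N; set N := #|free_orbits|.
have w_gt0 : (0 < w)%N by rewrite muln_gt0 !cardG_gt0.
have count e : #|[set B : {set F} | [&& #|B| == k, U \subset scal_stab B
    , G \subset transl_stab B & (0 \in B) == e]]|
    = #|[set X : {set {set F}} | X \subset free_orbits
          & (#|X| * w + e * #|G| == k)%N]|.
  rewrite -(card_in_imset (f := orbit_union e)); last first.
    by move=> X Y /[!inE] /andP[sX _] /andP[sY _]; apply: orbit_union_inj.
  apply: eq_card => B; rewrite inE.
  have := congr1 (fun S : {set {set F}} => B \in S) (invariant_orbit_union e).
  rewrite inE => ->.
  apply/andP/imsetP => [[/eqP cB /imsetP[X /[!inE] sX eB]]|].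
    by exists X; rewrite // inE sX -card_orbit_union -?eB ?cB /=.
  case=> X /[!inE] /andP[sX cX] ->; rewrite card_orbit_union //; split=> //.
  by rewrite imset_f // inE.
have draws e : (e * #|G| <= k)%N ->
  #|[set X : {set {set F}} | X \subset free_orbits
    & (#|X| * w + e * #|G| == k)%N]|
    = (if (w %| k - e * #|G|)%N then 'C(N, (k - e * #|G|) %/ w) else 0)%N.
  move=> le_k.
  have -> : [set X : {set {set F}} | X \subset free_orbits
                & (#|X| * w + e * #|G| == k)%N]
    = [set X : {set {set F}} | X \subset free_orbits
         & (#|X| * w == k - e * #|G|)%N].
    by apply/setP => X; rewrite !inE -[in RHS](eqn_add2r (e * #|G|)%N) subnK.
  case: ifPn => [/dvdnP[i ->]|ndvd].
    rewrite mulnK // -cards_draws; apply: eq_card => X; rewrite !inE.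
    by rewrite eqn_pmul2r.
  rewrite (_ : [set _ | _] = set0) ?cards0 //; apply/setP => X; rewrite !inE.
  by apply/andP => -[_ /eqP eX]; rewrite -eX dvdn_mull in ndvd.
rewrite -(cardsID [set B : {set F} | 0 \in B]) addnC.
rewrite [#|_ :\: _|](_ : _ = #|[set B : {set F} | [&& #|B| == k,
    U \subset scal_stab B, G \subset transl_stab B & (0 \in B) == false]]|);
  last first.
  apply: eq_card => B; rewrite !inE.
  by case: (0 \in B); rewrite ?andbT ?andbF //= !andbF.
rewrite [#|_ :&: _|](_ : _ = #|[set B : {set F} | [&& #|B| == k,
    U \subset scal_stab B, G \subset transl_stab B & (0 \in B) == true]]|);
  last first.
  apply: eq_card => B; rewrite !inE.
  by case: (0 \in B); rewrite ?andbT ?andbF //= !andbF.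
rewrite !count natrD /s_qk.
have -> : (#|F|%:R - #|G|%:R) / w%:R = N%:R :> rat.
  by rewrite card_free_orbits natrD addrK natrM mulfK // pnatr_eq0 -lt0n.
congr (_ + _).
  by rewrite draws // mul0n subn0 rbinom_ratio.
have [le_k|lt_k] := leqP #|G| k.
  by rewrite draws mul1n // -natrB // rbinom_ratio.
rewrite rbinom_neg; last first.
  by rewrite ltr_pdivrMr ?ltr0n // mul0r subr_lt0 ltr_nat.
rewrite (_ : [set _ | _] = set0) ?cards0 //.
apply/setP => X; rewrite !inE mul1n.
by apply/andP => -[_ /eqP eX]; rewrite -eX ltnNge leq_addl in lt_k.
Qed.

End InvariantSets.

(** * Stabilizers in the affine group *)

Section AffineStabilizer.

Variable F : finFieldType.
Implicit Types (B : {set F}) (G : {group F}) (a c : {unit F}) (b : F).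

Lemma ord2_case (i : 'I_2) : i = 0 \/ i = 1.
Proof. by case: i => [[|[|]]] // ?; [left | right]; apply: val_inj. Qed.

Lemma affine_inj c b c' b' : affine c b = affine c' b' -> c = c' /\ b = b'.
Proof.
move=> /(congr1 (@GLval _ _)) /matrixP eq; split.
  by apply: val_inj; have := eq 0 0; rewrite !mxE.
by have := eq 0 1; rewrite !mxE.
Qed.

Lemma affine1 : affine 1%g 0 = 1%g :> {'GL_2[F]}.
Proof.
apply: val_inj; apply/matrixP => i j; rewrite /= !mxE.
by case: (ord2_case i) => ->; case: (ord2_case j) => ->.
Qed.

Lemma affineM c b c' b' :
  (affine c b * affine c' b' = affine (c * c') (val c * b' + b))%g.
Proof.
apply: val_inj; apply/matrixP => i j.
rewrite /= -mulmxE !mxE !big_ord_recl big_ord0.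
case: (ord2_case i) => ->; case: (ord2_case j) => ->;
  by rewrite !mxE /= ?mulr0 ?mul0r ?mulr1 ?addr0 ?add0r.
Qed.

Lemma AGL1P g : g \in @AGL1 F -> exists c b, g = affine c b.
Proof.
rewrite inE => /andP[/eqP g10 /eqP g11].
have ug : GLval g 0 0 \is a GRing.unit.
  have := valP g; rewrite -[_ \is a GRing.unit]/(_ \in unitmx) unitmxE -det_tr.
  rewrite det_trig; last first.
    apply/is_trig_mxP => i j; rewrite mxE.
    by case: (ord2_case i) => ->; case: (ord2_case j) => ->.
  rewrite !big_ord_recl big_ord0 !mxE.
  have -> : lift ord0 (@ord0 0) = 1 :> 'I_2 by apply: val_inj.
  by rewrite g11 !mulr1.
exists (FinRing.unit F ug), (GLval g 0 1); apply: val_inj; apply/matrixP => i j.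
by case: (ord2_case i) => ->; case: (ord2_case j) => ->; rewrite !mxE.
Qed.

Lemma affine_stabP B c b :
  reflect {in B, forall x, val c * x + b \in B} (affine c b \in AGL1_stab B).
Proof.
rewrite inE affine_AGL1 /=.
have -> : [set AGL1_act (affine c b) x | x in B] = [set val c * x + b | x in B].
  by apply: eq_imset => x; rewrite AGL1_act_affine.
apply: (iffP eqP) => [eqB x xB|sB].
  by rewrite -eqB; apply: (imset_f (fun x => val c * x + b)).
apply/eqP; rewrite eqEcard card_imset ?leqnn ?andbT.
  by apply/subsetP => _ /imsetP[x xB ->]; apply: sB.
move=> x y /addIr /mulfI; apply.
by rewrite -unitfE (valP c).
Qed.

Lemma mem_Sabh a c b G : a \in scal_stab G ->
  (affine c b \in Sabh a 0 G) = (c \in <[a]>%g) && (b \in G).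
Proof.
move=> aG; have aGs : <[a]>%g \subset scal_stab G by rewrite cycle_subG.
have ET : group_set [set affine u.1 u.2 | u in setX <[a]>%g G].
  apply/group_setP; split.
    apply/imsetP; exists (1%g, 0); rewrite ?in_setX ?group1 ?addgroup0 //=.
    by rewrite affine1.
  move=> g g' /imsetP[[c1 b1] /setXP[/= c1a b1G] ->].
  case/imsetP=> -[c2 b2] /setXP[/= c2a b2G] ->.
  apply/imsetP; exists ((c1 * c2)%g, val c1 * b2 + b1); last exact: affineM.
  rewrite in_setX groupM //= addgroupD //.
  exact: (scal_stabP _ _ (subsetP aGs _ c1a)).
apply/idP/andP => [|[/cycleP[i ->] bG]].
  have /subsetP sub : Sabh a 0 G \subset Group ET.
    rewrite gen_subG subUset sub1set; apply/andP; split.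
      by apply/imsetP; exists (a, 0); rewrite ?in_setX ?cycle_id ?addgroup0.
    apply/subsetP => _ /imsetP[h hG ->].
    by apply/imsetP; exists (1%g, h); rewrite ?in_setX ?group1.
  by move/sub/imsetP => [[c' b'] /setXP[/= c'a b'G]] /affine_inj[-> ->].
have -> : affine (a ^+ i)%g b = (affine 1%g b * affine a 0 ^+ i)%g.
  have -> : (affine a 0 ^+ i = affine (a ^+ i) 0)%g.
    elim: i => [|i IHi]; first by rewrite !expg0 affine1.
    by rewrite !expgS IHi affineM mulr0 addr0.
  by rewrite affineM mulr0 add0r mul1g.
rewrite groupM ?groupX //; apply: mem_gen; rewrite inE.
  by apply/orP; right; apply: imset_f.
by rewrite inE eqxx.
Qed.

(** If [x |-> c x + b] preserves [B] and so does [x |-> a x], then so does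
    their commutator, the translation by [(1 - a) b]. *)
Lemma affine_stab_split B a c b : a \in scal_stab B -> a != 1%g ->
  affine c b \in AGL1_stab B -> c \in scal_stab B /\ b \in transl_stab B.
Proof.
move=> aB a_neq1 stab_cb; have /affine_stabP cbB := stab_cb.
have bB : b \in transl_stab B.
  have aT := subsetP (scal_stab_transl B) _ aB.
  apply: (@scal_stab_sub _ (transl_stab_group B) 1%g a);
    rewrite ?group1 1?eq_sym //.
  apply/transl_stabP => x xB.
  have aV : a^-1%g \in scal_stab_group B by rewrite groupV.
  (* with [x = a (c y + b)], the translate of [x] is the image of [a y] *)
  have [y yB eqx] : exists2 y, y \in B & val a^-1%g * x = val c * y + b.
    have := (scal_stabP _ _ aV) _ xB.
    move: stab_cb; rewrite inE => /andP[_ /eqP eB].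
    by rewrite -{1}eB => /imsetP[y yB]; rewrite AGL1_act_affine; exists y.
  have := cbB _ (scal_stabP _ _ aB y yB); congr (_ \in B).
  have -> : x = val a * (val c * y + b).
    by rewrite -eqx mulrA -FinRing.val_unitM mulgV mul1r.
  by rewrite FinRing.val_unit1; ring.
split=> //; apply/scal_stabP => x xB; apply: (transl_cancel bB).
by rewrite addrC; apply: cbB.
Qed.

Lemma AGL1_stab_eq_Sabh B a G : a \in scal_stab G -> a != 1%g ->
  (AGL1_stab B == Sabh a 0 G) =
  (scal_stab B == <[a]>%g) && (transl_stab B == G).
Proof.
move=> aG a_neq1.
have scalE c : (c \in scal_stab B) = (affine c 0 \in AGL1_stab B).
  by apply/scal_stabP/affine_stabP => cB x /cB; rewrite addr0.
have translE b : (b \in transl_stab B) = (affine 1%g b \in AGL1_stab B).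
  by apply/transl_stabP/affine_stabP => cB x /cB; rewrite mul1r addrC.
apply/eqP/andP => [eqS|[/eqP eqa /eqP eqG]].
  split; apply/eqP/setP => x.
    by rewrite scalE eqS mem_Sabh // addgroup0 andbT.
  by rewrite translE eqS mem_Sabh // group1.
have aB : a \in scal_stab B by rewrite eqa cycle_id.
apply/setP => g; have [gA|gNA] := boolP (g \in @AGL1 F); last first.
  rewrite inE (negPf gNA); apply/esym/negbTE.
  by apply: contra gNA; apply/subsetP/Sabh_sub.
have [c [b ->]] := AGL1P gA; rewrite mem_Sabh // -eqa -eqG.
apply/idP/andP => [/(affine_stab_split aB a_neq1)//|[/scal_stabP cB bB]].
apply/affine_stabP => x xB; rewrite addrC.
exact: (transl_stabP _ _ bB) (cB _ xB).
Qed.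

End AffineStabilizer.

(** * Alternating sums over sets of primes *)

Section PrimeDivisors.

(** Adding or removing a fixed element of [X] pairs off the terms. *)
Lemma alternating_subsets (R : numDomainType) (T : finType) (X : {set T}) :
  \sum_(P : {set T} | P \subset X) (-1) ^+ #|P| = (X == set0)%:R :> R.
Proof.
have [->|[x xX]] := set_0Vmem X.
  rewrite (big_pred1 set0) ?cards0 ?eqxx // => P.
  by rewrite subset0.
have -> : (X == set0) = false by apply/negbTE/set0Pn; exists x.
pose f (P : {set T}) := if x \in P then P :\ x else x |: P.
have fK : involutive f.
  move=> P; rewrite /f; have [xP|xP] := boolP (x \in P).
    by rewrite setD11 setD1K.
  by rewrite setU11 setU1K.
set S := \sum_(P | _) _; suff SN : S = - S.
  apply/eqP; have := mulrn_eq0 S 2.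
  by rewrite mulr2n {1}SN addNr eqxx orFb => <-.
rewrite {1}/S (reindex_inj (inv_inj fK)) /= -sumrN.
apply: eq_big => P; rewrite /f; case: ifPn => xP.
- by rewrite subDset (setUidPr _) // sub1set.
- by rewrite subUset sub1set xX.
- by rewrite (cardsD1 x P) xP exprS mulN1r opprK.
- by rewrite cardsU1 xP exprS mulN1r.
Qed.

Lemma setprod_dvdn n e (P : {set 'I_n}) :
  (forall i, i \in P -> prime i) ->
  (setprod P %| e)%N = [forall i in P, (i %| e)%N].
Proof.
move=> Pprime; apply/idP/forall_inP => [Pe i iP|Pe].
  by apply: dvdn_trans Pe; rewrite /setprod (bigD1 i) //= dvdn_mulr.
rewrite /setprod -big_enum /=.
have: all (fun i : 'I_n => prime i && (i %| e)%N) (enum P).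
  by apply/allP => i; rewrite mem_enum => iP; rewrite Pprime ?Pe.
elim: (enum P) (enum_uniq P) => [|i s IHs] /=.
  by rewrite big_nil dvd1n.
move=> /andP[is_ us] /andP[/andP[pi ie] alls].
rewrite big_cons Gauss_dvd ?ie ?IHs // prime_coprime // Euclid_dvd_prod //.
rewrite big_has; apply/hasPn => j js; have /allP/(_ j js)/andP[pj _] := alls.
by rewrite dvdn_prime2 //; apply: contra is_ => /eqP/val_inj ->.
Qed.

Lemma mem_prime_divisors n (P : {set 'I_n.+1}) i :
  P \subset prime_divisors n -> i \in P -> [&& prime i, (0 < n)%N & (i %| n)%N].
Proof. by move=> /subsetP sP /sP; rewrite inE mem_primes. Qed.

(** The sets of primes [P] with [d * setprod P] dividing [d * e] are exactly
    the sets of prime divisors of [e], which cancel unless [e = 1]. *)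
Lemma alternating_prime_divisors (d n m : nat) : (0 < d)%N -> (0 < n)%N ->
  (m %| d * n)%N ->
  \sum_(P : {set 'I_n.+1} | P \subset prime_divisors n)
    (-1) ^+ #|P| * (d * setprod P %| m)%:R = (m == d)%:R :> rat.
Proof.
move=> d_gt0 n_gt0 dvdm.
have [/dvdnP[e em]|ndm] := boolP (d %| m)%N; last first.
  rewrite big1 => [|P _].
    by case: eqP ndm => // ->; rewrite dvdnn.
  case: (boolP (_ %| m)%N) => [dP|]; last by rewrite mulr0.
  by case/negP: ndm; apply: dvdn_trans dP; apply: dvdn_mulr.
rewrite {m}em mulnC in dvdm *; rewrite dvdn_pmul2l // in dvdm.
pose X := [set i in prime_divisors n | (i %| e)%N].
transitivity (\sum_(P : {set 'I_n.+1} | P \subset X) (-1) ^+ #|P| : rat).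
  rewrite [RHS](eq_bigl (fun P : {set 'I_n.+1} =>
      (P \subset prime_divisors n) && (setprod P %| e)%N)) => [|P]; last first.
    rewrite /X setIdE subsetI; have [sP|//] := boolP (P \subset _).
    rewrite setprod_dvdn => [|i /(mem_prime_divisors sP)/and3P[]//].
    apply/subsetP/forall_inP => sub i /sub; first by rewrite inE.
    by rewrite inE.
  rewrite big_mkcondr /=; apply: eq_bigr => P _.
  by rewrite dvdn_pmul2l //; case: ifP; rewrite ?mulr1 ?mulr0.
rewrite alternating_subsets; congr (nat_of_bool _)%:R.
rewrite -{2}(muln1 d) eqn_pmul2l //; have [e1|ne1] := eqVneq e 1%N.
  apply/eqP/setP => i; rewrite !inE e1 dvdn1; apply/andP => -[].
  by rewrite mem_primes => /andP[/prime_gt1 + _] /eqP i1; rewrite i1.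
have e_gt0 : (0 < e)%N by apply: dvdn_gt0 dvdm.
have pe : prime (pdiv e) by rewrite pdiv_prime // ltn_neqAle eq_sym ne1.
have pn : (pdiv e < n.+1)%N.
  by rewrite ltnS dvdn_leq // (dvdn_trans (pdiv_dvd e)).
apply/negbTE/set0Pn; exists (Ordinal pn).
by rewrite !inE mem_primes /= pe n_gt0 pdiv_dvd (dvdn_trans (pdiv_dvd e)).
Qed.

End PrimeDivisors.

(** * Inclusion-exclusion *)

Lemma sumr_bool (R : pzSemiRingType) (T : finType) (A : {set T}) (b : pred T) :
  \sum_(i in A) (b i)%:R = #|[set i in A | b i]|%:R :> R.
Proof. by rewrite -natr_sum -big_mkcondr sum1dep_card. Qed.

Section Assembly.

Variable F : finFieldType.

(** Expanding both factors as cardinals, the left-hand side is a sum over pairs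
    [(G1, B)] with [G <= G1 <= transl_stab B]; for fixed [B] the sum over [G1]
    collapses by [subspaces_mobius]. *)
Lemma count_transl_stab (U : {group {unit F}}) (G : {group F}) n k :
  U \subset scal_stab G -> #|F| = (#|G| * #|scal_span U| ^ n)%N ->
  \sum_(0 <= l < n.+1)
    (-1) ^+ l * #|scal_span U|%:R ^+ 'C(l, 2)
    * gauss_binom #|scal_span U|%:R n l
    * s_qk #|F| k #|U| (#|G| * #|scal_span U| ^ l)
  = #|[set B : {set F} | [&& #|B| == k, U \subset scal_stab B
                           & transl_stab B == G]]|%:R.
Proof.
move=> stG cardF; set Q := #|scal_span U|.
pose Bk := [set B : {set F} | (#|B| == k) && (U \subset scal_stab B)].
have stT : U \subset scal_stab [set: F].
  by apply/subsetP => c _; apply/scal_stabP => x _; rewrite inE.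
have inner l : gauss_binom Q%:R n l * s_qk #|F| k #|U| (#|G| * Q ^ l)
    = \sum_(B in Bk) #|subspaces_between U G (transl_stab_group B) l|%:R.
  have sGT : G \subset [set: F]%G by exact: subsetT.
  rewrite -(card_subspaces_between l stG stT sGT); last by rewrite cardsT.
  rewrite mulr_natl -sumr_const.
  rewrite (eq_bigr (fun G1 : {group F} =>
      \sum_(B in Bk) (G1 \subset transl_stab B)%:R))
    => [|G1 /[!inE]]; last first.
    case/and4P=> _ _ stG1 /eqP <-; rewrite -card_invariant_sets // sumr_bool.
    by congr _%:R; apply: eq_card => B; rewrite !inE -andbA.
  rewrite exchange_big; apply: eq_bigr => B _; rewrite sumr_bool.
  congr _%:R; apply: eq_card => G1; rewrite !inE subsetT /=.
  by rewrite -!andbA; do !bool_congr.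
under eq_bigr do rewrite -mulrA inner mulr_sumr.
rewrite exchange_big /=.
have stTr B : B \in Bk -> U \subset scal_stab (transl_stab_group B).
  by rewrite inE => /andP[_ /subset_trans]; apply; apply: scal_stab_transl.
rewrite (eq_bigr (fun B => (transl_stab B == G)%:R)) => [|B /stTr stB].
  by rewrite sumr_bool; congr _%:R; apply: eq_card => B; rewrite !inE -andbA.
by rewrite subspaces_mobius // eq_sym.
Qed.

End Assembly.

Unset Implicit Arguments.

Theorem theorem4p4 (F : finFieldType) (p alpha : nat)
  (prime_p : prime p) (cardF : #|F| = (p ^ alpha)%N)
  (gamma : {unit F}) (gamma_gen : generator [set: {unit F}] gamma)
  (d beta : nat) (d_gt1 : (1 < d)%N) (d_dvd : (d %| #|F| - 1)%N)
  (H : {set F})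
  (HS : in_S (card_finPcharP cardF prime_p) (gamma ^+ ((#|F| - 1) %/ d))%g 0 H)
  (cardH : #|H| = (p ^ beta)%N)
  (k : nat) (k_le_q : (k <= #|F|)%N) :
  (Nstab (Sabh (gamma ^+ ((#|F| - 1) %/ d))%g 0 H) k)%:R =
  \sum_(P : {set 'I_((#|Hprime H| - 1) %/ d).+1}
          | P \subset prime_divisors ((#|Hprime H| - 1) %/ d))
    \sum_(0 <= l < ((alpha - beta) %/ ord_mod (d * setprod P) p).+1)
      (-1) ^+ (#|P| + l)
      * p%:R ^+ (ord_mod (d * setprod P) p * 'C(l, 2))
      * gauss_binom (p%:R ^+ ord_mod (d * setprod P) p)
          ((alpha - beta) %/ ord_mod (d * setprod P) p) l
      * s_qk #|F| k (d * setprod P)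
          (p ^ (beta + l * ord_mod (d * setprod P) p)) :> rat.
Proof.
have [[H0 Hlin] _] := HS; set a := (gamma ^+ _)%g in HS Hlin *.
have d_gt0 := ltnW d_gt1.
have order_a : #[a]%g = d.
  have card_unit : #[gamma]%g = (#|F| - 1)%N.
    by rewrite orderE -(eqP gamma_gen) card_finField_unit subn1.
  have F_gt1 : (0 < #|F| - 1)%N by rewrite subn_gt0 finNzRing_gt1.
  by rewrite orderXdiv card_unit ?dvdn_div // divnA // mulKn.
have a_neq1 : a != 1%g by rewrite -order_eq1 order_a gtn_eqF.
have HG : group_set H.
  apply/group_setP; split=> // x y Hx Hy.
  by have := Hlin 1 x y (mem1v _) Hx Hy; rewrite mul1r.
pose G := Group HG; rewrite -[H]/(G : {set F}) in cardH *.
have aG : a \in scal_stab G.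
  apply/scal_stabP => x Hx; rewrite -[_ * _]addr0.
  by apply: Hlin; rewrite // /Fp_adjoin memv_adjoin.
rewrite card_Hprime // subSS subn0; set n := (_ %/ d)%N.
have card_stabG : #|scal_stab G| = (d * n)%N.
  by rewrite mulnC divnK // -order_a (order_dvdG (G := scal_stab_group G)).
have n_gt0 : (0 < n)%N.
  have := cardG_gt0 (scal_stab_group G).
  by rewrite /= card_stabG muln_gt0 => /andP[].
(* The unit group of [Hprime H] is cyclic of order [d * n], so it has a subgroup
   of each order [d * setprod P]. *)
have /fin_all_exists[U UP] (P : {set 'I_n.+1}) : exists U : {group {unit F}},
    P \subset prime_divisors n ->
    #|U| = (d * setprod P)%N /\ U \subset scal_stab G.
  have [sP|_] := boolP (P \subset _); last by exists 1%G.
  have /cyclicP[g defG] := field_unit_group_cyclic (scal_stab_group G).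
  have dvdP : (d * setprod P %| d * n)%N.
    rewrite dvdn_pmul2l // setprod_dvdn; last first.
      by move=> i /(mem_prime_divisors sP)/and3P[].
    by apply/forall_inP => i /(mem_prime_divisors sP)/and3P[].
  exists <[g ^+ (d * n %/ (d * setprod P))]>%G => _; split.
    have og : #[g]%g = (d * n)%N by rewrite orderE -defG.
    have [f dn_eq] := dvdnP dvdP.
    have dn_gt0 : (0 < d * n)%N by rewrite muln_gt0 d_gt0.
    move: dn_gt0; rewrite -orderE dn_eq muln_gt0 => /andP[f_gt0 u_gt0].
    by rewrite mulnK // orderXdiv og dn_eq ?mulKn // dvdn_mulr.
  rewrite /= -[scal_stab G]/(scal_stab_group G : {set _}).
  by rewrite defG cycle_subG mem_cycle.
pose BG := [set B : {set F} | (#|B| == k) && (transl_stab B == G)].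
transitivity (\sum_(B in BG) (#|scal_stab B| == d)%:R : rat).
  rewrite sumr_bool; congr _%:R.
  apply: eq_card => B; rewrite !inE AGL1_stab_eq_Sabh // -andbA.
  congr (_ && _); rewrite andbC; congr (_ && _).
  rewrite -[scal_stab B]/(scal_stab_group B : {set _}).
  have cycF := field_unit_group_cyclic [set: {unit F}]%G.
  by rewrite -order_a orderE (eq_subG_cyclic cycF) ?subsetT.
transitivity (\sum_(P : {set 'I_n.+1} | P \subset prime_divisors n)
   \sum_(B in BG) (-1) ^+ #|P| * (U P \subset scal_stab B)%:R : rat).
  rewrite exchange_big /=; apply: eq_bigr => B.
  rewrite inE => /andP[_ /eqP defG].
  have sB : scal_stab B \subset scal_stab G by rewrite -defG scal_stab_transl.
  rewrite -(@alternating_prime_divisors d n) // -?card_stabG ?(cardSg sB) //.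
  apply: eq_bigr => P /UP[cardU sU]; rewrite -cardU.
  by rewrite (cardSg_cyclic (field_unit_group_cyclic (scal_stab_group G))).
apply: eq_bigr => P /UP[cardU sU]; rewrite -cardU; set o := ord_mod _ _.
have cardK : #|scal_span (U P)| = (p ^ o)%N.
  exact: card_scal_span prime_p cardF.
have stT : U P \subset scal_stab [set: F]%G.
  by apply/subsetP => c _; apply/scal_stabP => x _; rewrite inE.
have [r cardT] := card_subspace sU stT (subsetT G).
rewrite cardsT in cardT.
have -> : ((alpha - beta) %/ o)%N = r.
  have o_gt0 : (0 < o)%N.
    by have := card_scal_span_gt1 (U P); rewrite cardK; case: (o).
  have: (p ^ alpha)%N == (p ^ (beta + o * r))%N.
    by rewrite -cardF cardT cardH cardK expnD expnM.
  by rewrite eqn_exp2l ?prime_gt1 // => /eqP ->; rewrite addKn mulKn.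
transitivity ((-1) ^+ #|P| * \sum_(0 <= l < r.+1)
    (-1) ^+ l * #|scal_span (U P)|%:R ^+ 'C(l, 2)
    * gauss_binom #|scal_span (U P)|%:R r l
    * s_qk #|F| k #|U P| (#|G| * #|scal_span (U P)| ^ l)); last first.
  rewrite mulr_sumr; apply: eq_bigr => l _.
  rewrite cardH cardK natrX exprD exprM -expnM -expnD [(o * l)%N]mulnC.
  by rewrite !mulrA.
rewrite count_transl_stab // -mulr_sumr; congr (_ * _).
rewrite sumr_bool; congr _%:R.
by apply: eq_card => B; rewrite !inE -!andbA; do !bool_congr.
Qed.
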